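(* Let $1\le p<\infty$, let $\Sigma,\sigma,w$ be as in the context, let $S_w$ be the support of the equilibrium measure $\mu_w$, and for each $n$ let $P_n$ be an $L^p$-optimal polynomial of degree $n$. Let $K$ be a closed subset of $\mathbb{C}\setminus \mathrm{Co}(S_w)$, where $\mathrm{Co}(S_w)$ is the closed convex hull of $S_w$. Then there is $n_1\in\mathbb{N}$ such that for all $n>n_1$ the polynomial $P_n$ has no roots in $K$. In particular, for any $\epsilon>0$ there is $n_0\in\mathbb{N}$ such that for all $n>n_0$ all roots of $P_n$ are within distance $\epsilon$ of $\mathrm{Co}(S_w)$.
   Context: Setting. $\Sigma\subseteq\mathbb{C}$ is a closed set with reference measure $\sigma$, of one of the following kinds: a finite collection of Jordan curves (typical examples: the real axis or a union of intervals of it) with $\sigma$ the arc-length; a finite union of regions of the plane (e.g. $\Sigma=\mathbb{C}$) with $\sigma$ the area measure; or a finite union of elements of both types, with the corresponding measures. Weight. $w:\Sigma\to[0,\infty)$ is admissible: $w$ is upper semicontinuous; $\{z: w(z)>0\}$ has positive logarithmic capacity; $|z|w(z)\to0$ as $|z|\to\infty$ in $\Sigma$. Write $w=e^{-V}$; $V$ is called the potential. Equilibrium measure. For a probability measure $\mu$ on $\Sigma$ put $\mathcal{I}_w[\mu]=\iint \ln\frac1{|z-t|}\,d\mu(z)\,d\mu(t)+2\int V\,d\mu$. There is a unique minimizing probability measure $\mu_w$, the equilibrium measure; its support $S_w$ is compact. Optimal polynomials. For $1\le p<\infty$ let $\|Qw^n\|_p=\left(\int_\Sigma |Q|^pw^{np}\,d\sigma\right)^{1/p}$.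 It is assumed that the extremal problem is well posed: $0<\|Qw^n\|_p<\infty$ for every nonzero polynomial $Q$ of degree $\le n$. An $L^p$-optimal polynomial $P_n$ is a monic polynomial of degree $n$ that minimizes $\|Qw^n\|_p$ over all monic polynomials $Q$ of degree $n$. Standing localization property (assumed to hold for $\Sigma,\sigma,w,p$): for every bounded open set $\mathcal{N}\supset S_w$ there are constants $c>0$ and $C$, depending only on $w,p,\mathcal{N}$, such that for every $n$ and every polynomial $P$ of degree $\le n$, $\int_\Sigma|Pw^n|^p\,d\sigma\le(1+Ce^{-cn})\int_{\mathcal{N}\cap\Sigma}|Pw^n|^p\,d\sigma$. *)

(* Defs.v *)
From HB Require Import structures.
From mathcomp Require Import all_boot all_order all_algebra.
From mathcomp Require Export complex.
From mathcomp Require Import all_classical all_reals all_analysis.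

Set Implicit Arguments.
Unset Strict Implicit.
Unset Printing Implicit Defensive.

Import Order.TTheory GRing.Theory Num.Theory.
Import numFieldNormedType.Exports.
Import Normc.

Local Open Scope classical_set_scope.
Local Open Scope complex_scope.
Local Open Scope ring_scope.

(* The complex plane [R[i]] carries the topology of its norm and the Borel
   sigma-algebra of that topology.  The modulus as an element of [R] is
   [normc]; the library norm [`|z|] is the same number seen in [R[i]]. *)
HB.instance Definition _ (R : realType) := NormedModule.copy R[i] R[i]^o.
HB.instance Definition _ (R : realType) :=
  Measurable.copy R[i] (g_sigma_algebraType (@open R[i])).

Section reference_measure.
Context {R : realType}.
Local Open Scope ereal_scope.

Definition curve_length (g : R -> R[i]) (a b : R) : \bar R :=
  ereal_sup [set (\sum_(0 <= k < size s)
     normc (g (nth b (a :: s) k.+1) - g (nth b (a :: s) k)))%R%:E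
   | s in itv_partition a b].

(* A simple arc, a simple closed curve (endpoints of J identified), or a simple
   curve through infinity (J unbounded, as for the real axis); in the last case
   g must leave every bounded set at each infinite end of J. *)
Definition jordan_curve (J : set R) (g : R -> R[i]) : Prop :=
  [/\ is_interval J /\ closed J,
      exists s t, [/\ J s, J t & (s < t)%R],
      {within J, continuous g},
      forall s t, J s -> J t -> (s < t)%R -> g s = g t ->
        lbound J s /\ ubound J t &
      forall M : R, exists T : R, forall t, J t -> (T < `|t|)%R ->
        (M < normc (g t))%R].

Definition closed_region (D : set R[i]) : Prop :=
  exists U : set R[i], [/\ open U, connected U, U !=set0 & D = closure U].

Definition area (A : set R[i]) : \bar R :=
  (lebesgue_measure \x lebesgue_measure)
    [set xy : R * R | A (xy.1 +i* xy.2)].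

(* [ell] is the arc length on the union of the curves: prescribing the measure
   of every subarc counts a piece shared by several curves only once. *)
Definition arc_length_measure (m : nat) (J : 'I_m -> set R)
    (g : 'I_m -> R -> R[i]) (ell : {measure set R[i] -> \bar R}) : Prop :=
  ell (~` \bigcup_i (g i @` J i)) = 0 /\
  forall i a b, J i a -> J i b -> (a <= b)%R ->
    ell (g i @` `[a, b]) = curve_length (g i) a b.

Definition reference_measure (Sigma : set R[i])
    (sigma : {measure set R[i] -> \bar R}) : Prop :=
  exists (m k : nat) (J : 'I_m -> set R) (g : 'I_m -> R -> R[i])
      (D : 'I_k -> set R[i]) (ell : {measure set R[i] -> \bar R}),
  [/\ forall i, jordan_curve (J i) (g i),
      forall j, closed_region (D j),
      Sigma = (\bigcup_i (g i @` J i)) `|` \bigcup_j D j,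
      arc_length_measure J g ell &
      forall A, measurable A ->
        sigma A = ell A + area (A `&` \bigcup_j D j)].

End reference_measure.

Section potential_theory.
Context {R : realType}.
Local Open Scope ereal_scope.

(* [lne 0 = -oo], so the kernel ln(1/|z-t|) is [+oo] on the diagonal. *)
Definition log_energy (mu : probability R[i] R) : \bar R :=
  \int[mu \x mu]_x (- lne (normc (x.1 - x.2))%:E).

Definition log_capacity (E : set R[i]) : \bar R :=
  expeR (- ereal_inf [set log_energy mu | mu in
    [set mu : probability R[i] R |
       exists K : set R[i], [/\ compact K, K `<=` E & mu K = 1]]]).

Definition admissible (Sigma : set R[i]) (w : R[i] -> R) : Prop :=
  [/\ forall z, Sigma z -> (0 <= w z)%R,
      forall z a, Sigma z -> (w z < a)%R ->
        \forall y \near within Sigma (nbhs z), (w y < a)%R,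
      0 < log_capacity [set z | Sigma z /\ (0 < w z)%R] &
      forall e : R, (0 < e)%R -> exists M : R, forall z,
        Sigma z -> (M < normc z)%R -> (normc z * w z < e)%R].

(* Equals [+oo] where w vanishes. *)
Definition potential (w : R[i] -> R) (z : R[i]) : \bar R := - lne (w z)%:E.

(* [dual_adde] is the addition with [+oo - oo = +oo].  The potential of an
   admissible weight is bounded below by ln|z| up to a constant, so if the
   negative part of the logarithmic kernel is not integrable then the integral
   of the potential is [+oo]: measures for which the energy would be an
   indeterminate form get energy [+oo] and do not compete for the minimum. *)
Definition weighted_energy (Sigma : set R[i]) (w : R[i] -> R)
    (mu : probability R[i] R) : \bar R :=
  dual_adde (log_energy mu) (2%:E * \int[mu]_(z in Sigma) potential w z).

Definition equilibrium_measure (Sigma : set R[i]) (w : R[i] -> R)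
    (mu : probability R[i] R) : Prop :=
  mu Sigma = 1 /\
  forall nu : probability R[i] R, nu Sigma = 1 ->
    weighted_energy Sigma w mu <= weighted_energy Sigma w nu.

Definition measure_support (mu : {measure set R[i] -> \bar R}) : set R[i] :=
  [set z | forall U : set R[i], open U -> U z -> 0 < mu U].

(* [Rcomplex R] is [R[i]] as a real vector space. *)
Definition closed_convex_hull (S : set R[i]) : set R[i] :=
  smallest [set A : set R[i] | closed A /\ @convex_set R (Rcomplex R) A] S.

End potential_theory.

Section optimal_polynomials.
Context {R : realType}.
Context (Sigma : set R[i]) (sigma : {measure set R[i] -> \bar R}).
Context (w : R[i] -> R) (p : R).
Local Open Scope ereal_scope.

Definition weighted_integral (A : set R[i]) (n : nat) (Q : {poly R[i]}) :
    \bar R :=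
  \int[sigma]_(z in A) (normc Q.[z] `^ p * w z `^ (n%:R * p))%R%:E.

Definition weighted_norm (n : nat) (Q : {poly R[i]}) : \bar R :=
  weighted_integral Sigma n Q `^ p^-1.

(* Degrees are positive: for n = 0 the weight disappears, and the two
   properties below would fail on every Sigma with sigma Sigma = +oo. *)
Definition well_posed : Prop :=
  forall (n : nat) (Q : {poly R[i]}), (0 < n)%N -> Q != 0%R ->
    (size Q <= n.+1)%N -> 0 < weighted_norm n Q < +oo.

Definition localization (S : set R[i]) : Prop :=
  forall N : set R[i], open N -> bounded_set N -> S `<=` N ->
  exists c C : R, (0 < c)%R /\
    forall (n : nat) (P : {poly R[i]}), (0 < n)%N -> (size P <= n.+1)%N ->
      weighted_integral Sigma n P <=
      (1 + C * expR (- (c * n%:R)))%R%:E * weighted_integral (N `&` Sigma) n P.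

Definition optimal_poly (n : nat) (P : {poly R[i]}) : Prop :=
  [/\ P \is monic, size P = n.+1 &
      forall Q : {poly R[i]}, Q \is monic -> size Q = n.+1 ->
        weighted_norm n P <= weighted_norm n Q].

End optimal_polynomials.

(* Main.v *)
Require Import Defs.
From mathcomp Require Import all_boot all_order all_algebra.
From mathcomp Require Import all_classical all_reals all_analysis.
From mathcomp Require Import measurable_realfun.
From mathcomp Require Import ring lra.

(** The proof moves one root.  Suppose that P_n vanishes at a point z0 of K,
    write P_n = (X - z0) q, and let z1 be the projection of z0 on the convex
    hull Co of the support.  The segment from z1 to z0 makes an obtuse angle
    with Co, so |z - z1| <= rho |z - z0| for all z in some neighbourhood N of
    Co, with a constant rho < 1 that depends only on the size of Co and on its
    distance to K ([projection_contracts]).  Hence Q = (X - z1) q is monic of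
    the same degree, and its weighted integral over N is at most rho^p times
    that of P_n.  By localization its integral over the whole of Sigma is at
    most (1 + C e^(-cn)) rho^p times that of P_n.  This factor is smaller than
    1 for large n, against the optimality of P_n ([optimal_poly_no_root]).  The
    statement about distances is the special case where K is the complement of
    the eps-neighbourhood of Co.

    Localization speaks of bounded neighbourhoods only, so the argument needs
    the support of the equilibrium measure to be bounded, and this is where
    its minimality enters ([equilibrium_support_bounded]).  With
    l(z) = ln(1 + |z|), the weighted energy of nu is, up to a constant,
    the sum of the double integral of k(z,t) = l(z) + l(t) - ln|z - t| and of
    twice the integral of H = V - l + ln B.  Both integrands are nonnegative,
    and H tends to infinity with |z| because |z| w(z) tends to 0.  Positive
    capacity yields one measure of finite energy ([exists_finite_energy]), so
    the minimum E is finite.  If mu gave mass 1 - a > 0 to the outside of a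
    disk beyond which H >= E + 1, then conditioning mu on the disk would give
    a measure of energy smaller than E. *)

Import Order.TTheory GRing.Theory Num.Theory.
Import numFieldNormedType.Exports.
Import Normc.

Local Open Scope classical_set_scope.
Local Open Scope complex_scope.
Local Open Scope ring_scope.

(** * Topology of the complex plane in terms of the real-valued modulus *)

Section plane.
Context {R : realType}.
Implicit Types (x y z : R[i]) (A : set R[i]).

Lemma normc_ge0 z : 0 <= normc z.
Proof. by case: z => a b; exact: sqrtr_ge0. Qed.

Lemma normc_sqr (a b : R) : normc (a +i* b) ^+ 2 = a ^+ 2 + b ^+ 2.
Proof. by rewrite /= sqr_sqrtr// addr_ge0// sqr_ge0. Qed.

Lemma normcB x y : normc (x - y) = normc (y - x).
Proof. by rewrite -normcN opprB. Qed.

Lemma normcDB x y z : normc (x - z) <= normc (x - y) + normc (y - z).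
Proof. by rewrite -[X in normc X](subrKA y); exact: le_normcD. Qed.

Lemma normc_Re z : `|complex.Re z| <= normc z.
Proof.
by case: z => a b /=; rewrite -sqrtr_sqr ler_wsqrtr// lerDl sqr_ge0.
Qed.

Lemma normc_Im z : `|complex.Im z| <= normc z.
Proof.
by case: z => a b /=; rewrite -sqrtr_sqr ler_wsqrtr// lerDr sqr_ge0.
Qed.

Lemma normc_le_ReIm z : normc z <= `|complex.Re z| + `|complex.Im z|.
Proof.
case: z => a b /=.
rewrite -[leRHS]ger0_norm ?addr_ge0//.
rewrite -sqrtr_sqr ler_wsqrtr// sqrrD !real_normK ?num_real//.
by rewrite -addrA [_ *+ 2 + _]addrC addrA lerDl mulrn_wge0// mulr_ge0.
Qed.

(** The norm of [R[i]] takes values in [R[i]], where the order is partial; this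
    translates neighbourhoods to radii and moduli in [R]. *)
Lemma nbhs_normc z A :
  nbhs z A <-> exists2 e : R, 0 < e & forall y, normc (z - y) < e -> A y.
Proof.
split.
  move=> /nbhs_ballP[e/= e0 eA].
  exists (complex.Re e).
    by move: e0; rewrite ltcE/= => /andP[].
  move=> y zy; apply: eA; rewrite -ball_normE/=.
  move: e0; rewrite !ltcE/= => /andP[/eqP <- e0].
  by case: (z - y) zy => a b /= ->; rewrite eqxx.
move=> [e e0 eA]; apply/nbhs_ballP; exists (e%:C) => /=.
  by rewrite ltcE/= eqxx.
move=> y; rewrite -ball_normE/= => zy; apply: eA.
by move: zy; rewrite ltcE/=; case: (z - y) => a b /= /andP[].
Qed.

Lemma openP_normc A :
  open A <-> forall z, A z ->
    exists2 e : R, 0 < e & forall y, normc (z - y) < e -> A y.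
Proof.
rewrite openE; split => h z Az; apply/nbhs_normc; exact: h.
Qed.

Lemma continuous_normcB z : continuous (fun x => normc (z - x)).
Proof.
move=> x B /nbhs_ballP[e/= e0 eB]; apply/nbhs_normc; exists e => // y xy.
apply: eB; rewrite /ball/= ltr_distlC; apply/andP; split.
  rewrite ltrBlDr; apply: le_lt_trans (normcDB z y x) _.
  by rewrite ltrD2l normcB.
by apply: le_lt_trans (normcDB z x y) _; rewrite ltrD2l.
Qed.

Lemma continuous_normc : continuous (fun x => normc x).
Proof.
rewrite [X in continuous X](_ : _ = fun x => normc (0 - x)).
  exact: continuous_normcB.
by apply/funext => x; rewrite sub0r normcN.
Qed.

Lemma bounded_normc A :
  (exists M : R, forall z, A z -> normc z <= M) -> bounded_set A.
Proof.
move=> [M AM]; exists M%:C; split.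
  by apply/complex_realP; exists M.
move=> x Mx z /AM zM; apply: le_trans (ltW Mx).
by rewrite lecE/= eqxx; case: z zM.
Qed.

(** Since the norm of [R[i]] is not real-valued, this is proved by covering:
    near every point the modulus is bounded by all large enough reals. *)
Lemma compact_normc_bounded A : compact A ->
  exists M : R, forall z, A z -> normc z <= M.
Proof.
move=> /compact_near_coveringP /(_ R +oo (fun M z => normc z <= M) _)[].
  move=> z _; exists ([set y | normc (z - y) < 1], [set M | normc z + 1 < M]).
    split => /=; first by apply/nbhs_normc; exists 1.
    by exists (normc z + 1); split; rewrite ?num_real.
  move=> [y M] /= [zy zM]; apply: le_trans (ltW zM).
  rewrite -[leLHS]normcN -sub0r; apply: le_trans (normcDB _ z _) _.
  by rewrite sub0r normcN lerD2l ltW.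
move=> M [_ h]; exists (M + 1); apply: h.
by rewrite ltrDl.
Qed.

(** Heine-Borel: the set is a closed part of the image of a compact square. *)
Lemma closed_normc_compact A :
  closed A -> (exists M : R, forall z, A z -> normc z <= M) -> compact A.
Proof.
move=> cA [M AM].
pose f (u : R * R) : R[i] := u.1 +i* u.2.
have cf : continuous f.
  move=> [a b] B /nbhs_normc[e e0 eB].
  exists (ball a (e / 2), ball b (e / 2)).
    by split => /=; apply: nbhsx_ballx; rewrite divr_gt0.
  move=> [c d] [/= ac bd]; apply: eB.
  apply: le_lt_trans (normc_le_ReIm _) _ => /=.
  rewrite [e]splitr; apply: ltrD; first exact: ac.
  exact: bd.
have cQ : compact (f @` (`[- M, M] `*` `[- M, M])).
  apply: continuous_compact; first exact: continuous_subspaceT.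
  by apply: compact_setX; exact: segment_compact.
apply: subclosed_compact cA cQ _ => -[a b] /AM zM.
exists (a, b) => //=; rewrite !in_itv/= -!ler_norml.
split; [exact: le_trans (normc_Re _) zM|exact: le_trans (normc_Im _) zM].
Qed.
End plane.

(** * Convex sets of the plane and projections *)

Section convex.
Context {R : realType}.
Implicit Types (x y z u v : R[i]) (A S : set R[i]).

Definition convex_comb (t : R) x y : R[i] := t%:C * x + (1 - t)%:C * y.

Lemma convex_setP A : @convex_set R (Rcomplex R) A <->
  forall x y t, A x -> A y -> 0 <= t -> t <= 1 -> A (convex_comb t x y).
Proof.
have E (t : {i01 R}) x y :
    convex_comb t%:num x y = conv t (x : convex_lmodType (Rcomplex R)) y.
  case: x y => [a b] [c d]; apply/eqP; rewrite eq_complex /=.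
  by rewrite !mul0r !subr0 !addr0 !eqxx.
split=> h.
  move=> x y t Ax Ay t0 t1; have := h x y (Itv01 t0 t1).
  by rewrite !inE -E; exact.
move=> x y l; rewrite !inE => Ax Ay; rewrite -E.
by apply: h.
Qed.

Lemma closed_convex_hull_sub S : S `<=` closed_convex_hull S.
Proof. exact: sub_smallest. Qed.

Lemma closed_convex_hull_closed S : closed (closed_convex_hull S).
Proof. by apply: closed_bigI => A [[]]. Qed.

Lemma closed_convex_hull_convex S x y t : closed_convex_hull S x ->
  closed_convex_hull S y -> 0 <= t -> t <= 1 ->
  closed_convex_hull S (convex_comb t x y).
Proof.
move=> Sx Sy t0 t1 A AP; have [[_ /convex_setP cA] _] := AP.
by apply: cA => //; [exact: Sx|exact: Sy].
Qed.

Lemma closed_normc_le (M : R) : closed [set z : R[i] | normc z <= M].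
Proof.
rewrite (_ : mkset _ = (fun z : R[i] => normc z) @^-1` [set r | r <= M])//.
by apply: closed_comp => [z _|]; [exact: continuous_normc|exact: closed_le].
Qed.

Lemma closed_convex_hull_bounded S (M : R) : (forall z, S z -> normc z <= M) ->
  forall z, closed_convex_hull S z -> normc z <= M.
Proof.
move=> SM z Sz; apply: (Sz [set x | normc x <= M]); split; last exact: SM.
split; first exact: closed_normc_le.
apply/convex_setP => x y t /= xM yM t0 t1.
apply: le_trans (le_normcD _ _) _; rewrite !normcM /=.
rewrite !expr0n /= !addr0 !sqrtr_sqr.
rewrite !ger0_norm ?subr_ge0//.
have -> : M = t * M + (1 - t) * M by ring.
by apply: lerD; apply: ler_wpM2l => //; rewrite subr_ge0.
Qed.

Definition dotc x y : R :=
  complex.Re x * complex.Re y + complex.Im x * complex.Im y.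

Lemma dotcc x : dotc x x = normc x ^+ 2.
Proof. by case: x => a b; rewrite normc_sqr /dotc /= -!expr2. Qed.

Lemma dotcDl x y z : dotc (x + y) z = dotc x z + dotc y z.
Proof. by case: x y z => [? ?] [? ?] [? ?]; rewrite /dotc /=; ring. Qed.

Lemma normcB_sqr x y :
  normc (x - y) ^+ 2 = normc x ^+ 2 - 2 * dotc x y + normc y ^+ 2.
Proof.
by rewrite -!dotcc; case: x y => [? ?] [? ?]; rewrite /dotc /=; ring.
Qed.

Lemma dotc_le x y : dotc x y <= normc x * normc y.
Proof.
apply: le_trans (ler_norm _) _.
rewrite -[leRHS]ger0_norm ?mulr_ge0 ?normc_ge0//.
rewrite -ler_sqr ?nnegrE// !real_normK ?num_real// exprMn -!dotcc.
case: x y => [a b] [c d]; rewrite /dotc /= -subr_ge0.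
have -> : (a * a + b * b) * (c * c + d * d) - (a * c + b * d) ^+ 2
  = (a * d - b * c) ^+ 2 by ring.
exact: sqr_ge0.
Qed.

(** The projection is a point [z1] at minimal distance from [z0].  If [y] in the
    set saw [z0] from [z1] under an acute angle, a small step from [z1] towards
    [y] would stay in the set and come closer to [z0]. *)
Lemma convex_projection A (z0 : R[i]) : A !=set0 -> compact A ->
  (forall x y t, A x -> A y -> 0 <= t -> t <= 1 -> A (convex_comb t x y)) ->
  exists2 z1, A z1 & forall y, A y -> dotc (y - z1) (z0 - z1) <= 0.
Proof.
move=> A0 cptA cA.
have [|z1 Az1 z1min] :=
  @compact_EVT_min _ _ (fun z => normc (z0 - z)) A A0 cptA.
  by apply: continuous_subspaceT; exact: continuous_normcB.
exists z1; first by rewrite inE in Az1.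
move=> y Ay; rewrite leNgt; apply/negP => k0.
set k := dotc _ _ in k0; set m := normc (y - z1) ^+ 2.
have m0 : 0 <= m by exact: sqr_ge0.
(* A step of length t towards y changes the squared distance to z0 by
   t (t m - 2 k), which is negative as soon as t m <= k. *)
pose t := k / (m + k).
have mk : 0 < m + k by lra.
have t0 : 0 < t by exact: divr_gt0.
have t1 : t <= 1 by rewrite ler_pdivrMr// mul1r lerDr.
have /z1min : convex_comb t y z1 \in A.
  by rewrite inE; apply: cA => //; [rewrite inE in Az1|exact: ltW].
rewrite -ler_sqr ?nnegrE ?normc_ge0//.
have -> : z0 - convex_comb t y z1 = (z0 - z1) - t%:C * (y - z1).
  by rewrite /convex_comb rmorphB rmorph1; ring.
rewrite [leRHS]normcB_sqr normcM exprMn.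
have -> : dotc (z0 - z1) (t%:C * (y - z1)) = t * k.
  rewrite /k; case: (z0 - z1) (y - z1) => [? ?] [? ?]; rewrite /dotc /=; ring.
have -> : normc t%:C ^+ 2 = t ^+ 2.
  by rewrite /= expr0n /= addr0 sqrtr_sqr real_normK// num_real.
rewrite -/m -subr_ge0 [X in 0 <= X](_ : _ = t * (t * m - 2 * k)); last by ring.
rewrite pmulr_rge0// subr_ge0 => h.
have : t * m <= k.
  by rewrite mulrAC ler_pdivrMr//; apply: ler_wpM2l; lra.
lra.
Qed.

(** Near each point of the compact set a positive lower bound of the distance to
    [K] holds; compactness makes it uniform. *)
Lemma closed_compact_dist K A : closed K -> compact A -> K `<=` ~` A ->
  exists2 d : R, 0 < d & forall x y, K x -> A y -> d <= normc (x - y).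
Proof.
move=> cK /compact_near_coveringP cA KA.
have [|e /=[/= e0 h]] :=
  cA R 0^'+ (fun d y => forall x, K x -> d <= normc (x - y)) _.
  move=> y Ay.
  have : open (~` K) by exact: closed_openC.
  move=> /openP_normc /(_ y)[|e e0 eK]; first by move=> /KA.
  exists ([set z | normc (y - z) < e / 2], [set d | d < e / 2]).
    split=> /=.
      by apply/nbhs_normc; exists (e / 2) => //; exact: divr_gt0.
    by apply: nbhs_right_lt; exact: divr_gt0.
  move=> [z d] /= [yz de] x Kx; rewrite leNgt; apply/negP => xz.
  apply: (eK x _ Kx); apply: le_lt_trans (normcDB _ z _) _.
  rewrite [e]splitr; apply: ltrD => //.
  by rewrite normcB; apply: lt_trans de.
exists (e / 2); first exact: divr_gt0.
move=> x y Kx Ay; apply: (h (e/2)) => //=; last exact: divr_gt0.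
by rewrite sub0r normrN gtr0_norm ?divr_gt0// ltr_pdivrMr// ltr_pMr// ltr1n.
Qed.

Definition neighbourhood A (d : R) : set R[i] :=
  [set z | exists2 y, A y & normc (z - y) < d].

Lemma neighbourhood_open A d : open (neighbourhood A d).
Proof.
apply/openP_normc => z [y Ay zy]; exists (d - normc (z - y)).
  by rewrite subr_gt0.
move=> x zx; exists y => //; apply: le_lt_trans (normcDB _ z _) _.
by rewrite -ltrBrDr normcB.
Qed.

Lemma neighbourhood_bounded A d (M : R) : (forall z, A z -> normc z <= M) ->
  forall z, neighbourhood A d z -> normc z <= M + d.
Proof.
move=> AM z [y /AM yM zy]; rewrite -[z in leLHS](subrK y).
by apply: le_trans (le_normcD _ _) _; rewrite addrC lerD// ltW.
Qed.

Lemma sub_neighbourhood A d : 0 < d -> A `<=` neighbourhood A d.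
Proof. by move=> d0 x Ax; exists x => //; rewrite subrr normc0. Qed.

(** Put a = z - z1 and u = z0 - z1, where z1 is the projection of z0.  The
    obtuse angle gives <a, u> <= (d/4) |u| for z in the neighbourhood of size
    d/4, so |z - z0|^2 = |a|^2 - 2 <a, u> + |u|^2 >= |a|^2 + d^2/2, because
    |u| >= d.
    As |a| is at most L = 2 M + d, the ratio |a|^2 / |z - z0|^2 is at most
    L^2 / (L^2 + d^2/2), uniformly in z0. *)
Lemma projection_contracts A (M d : R) : A !=set0 -> compact A ->
  (forall x y t, A x -> A y -> 0 <= t -> t <= 1 -> A (convex_comb t x y)) ->
  (forall z, A z -> normc z <= M) -> 0 < d ->
  exists2 rho : R, 0 <= rho < 1 &
    forall z0, (forall y, A y -> d <= normc (z0 - y)) ->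
    exists z1, forall z, neighbourhood A (d / 4) z ->
      normc (z - z1) <= rho * normc (z - z0).
Proof.
move=> A0 cptA cA AM d0.
have M0 : 0 <= M by case: A0 => y /AM; apply: le_trans; exact: normc_ge0.
pose L := 2 * M + d.
have L0 : 0 < L by rewrite /L; lra.
have L2 : 0 < L ^+ 2 by rewrite exprn_gt0.
have d2 : 0 < d ^+ 2 by rewrite exprn_gt0.
pose r2 := L ^+ 2 / (L ^+ 2 + d ^+ 2 / 2).
have r20 : 0 <= r2 by apply: divr_ge0; lra.
exists (Num.sqrt r2).
  rewrite sqrtr_ge0 -sqrtr1 ltr_sqrt// ltr_pdivrMr; lra.
move=> z0 z0d; have [z1 Az1 h] := convex_projection A z0 A0 cptA cA.
exists z1 => z Nz; have [y Ay zy] := Nz.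
have zM := neighbourhood_bounded _ _ _ AM z Nz.
have aL : normc (z - z1) <= L.
  apply: le_trans (le_normcD _ _) _; rewrite normcN.
  have := AM _ Az1; rewrite /L; lra.
have D := z0d _ Az1.
set a := z - z1; set u := z0 - z1.
have au : dotc a u <= d / 4 * normc u.
  have -> : a = (z - y) + (y - z1) by rewrite addrA subrK.
  rewrite dotcDl; apply: le_trans (lerD (dotc_le _ _) (h _ Ay)) _.
  by rewrite addr0 ler_wpM2r ?normc_ge0// ltW.
have zz0 : normc a ^+ 2 + d ^+ 2 / 2 <= normc (z - z0) ^+ 2.
  have -> : z - z0 = a - u by rewrite /a /u opprB addrA subrK.
  rewrite normcB_sqr.
  have : d * normc u <= normc u ^+ 2 by rewrite expr2 ler_wpM2r ?normc_ge0.
  have : d ^+ 2 <= normc u ^+ 2 by rewrite ler_sqr// nnegrE ?normc_ge0// ltW.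
  lra.
rewrite -ler_sqr ?nnegrE ?normc_ge0//; last first.
  by rewrite mulr_ge0 ?normc_ge0// sqrtr_ge0.
rewrite exprMn sqr_sqrtr//.
apply: le_trans (ler_wpM2l r20 zz0).
rewrite /r2 mulrAC ler_pdivlMr; last by lra.
rewrite -/a !mulrDr [_ ^+ 2 * L ^+ 2]mulrC lerD2l ler_wpM2r//; first by lra.
by rewrite ler_sqr// ?nnegrE ?normc_ge0// ltW.
Qed.

End convex.

(** * Borel functions on the plane *)

Section borel.
Context {R : realType}.

Lemma open_measurableC (A : set R[i]) : open A -> measurable A.
Proof. exact: sub_sigma_algebra. Qed.

Lemma closed_measurableC (A : set R[i]) : closed A -> measurable A.
Proof.
move=> cA; rewrite -[A]setCK; apply: measurableC.
by apply: open_measurableC; exact: closed_openC.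
Qed.

(** The sets [f < a] generate the Borel structure of the line, so upper
    semicontinuity is enough. *)
Lemma usc_measurable (f : R[i] -> R) :
  (forall a, open [set z | f z < a]) -> measurable_fun setT f.
Proof.
move=> fo; apply: (measurability (@RGenInftyO.G R)).
  exact: RGenInftyO.measurableE.
move=> /= _ [_ [a ->] <-]; rewrite setTI; apply: open_measurableC.
have -> : f @^-1` `]-oo, a[ = [set z | f z < a].
  by apply/seteqP; split => z /=; rewrite in_itv.
exact: fo.
Qed.

Lemma continuous_measurableC (f : R[i] -> R) :
  continuous f -> measurable_fun setT f.
Proof.
move=> cf; apply: usc_measurable => a.
apply: (@open_comp _ _ f [set x | x < a]) => [z _|]; first exact: cf.
exact: open_lt.
Qed.

Lemma measurable_Re : measurable_fun setT (fun z : R[i] => complex.Re z).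
Proof.
apply: continuous_measurableC => z B /nbhs_ballP[e/= e0 eB]; apply/nbhs_normc.
exists e => // y zy; apply: eB; apply: le_lt_trans zy.
by apply: le_trans (normc_Re (z - y)); case: z y => [? ?] [? ?].
Qed.

Lemma measurable_Im : measurable_fun setT (fun z : R[i] => complex.Im z).
Proof.
apply: continuous_measurableC => z B /nbhs_ballP[e/= e0 eB]; apply/nbhs_normc.
exists e => // y zy; apply: eB; apply: le_lt_trans zy.
by apply: le_trans (normc_Im (z - y)); case: z y => [? ?] [? ?].
Qed.

Lemma measurable_normc_ReIm d (T : measurableType d) (f : T -> R[i]) :
  measurable_fun setT (fun t => complex.Re (f t)) ->
  measurable_fun setT (fun t => complex.Im (f t)) ->
  measurable_fun setT (fun t => normc (f t)).
Proof.
move=> fRe fIm.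
have -> : (fun t => normc (f t)) =
    Num.sqrt \o (fun t => complex.Re (f t) ^+ 2 + complex.Im (f t) ^+ 2).
  by apply/funext => t /=; case: (f t).
apply: measurableT_comp.
  by apply: continuous_measurable_fun; exact: sqrt_continuous.
by apply: measurable_funD; apply: measurable_funX.
Qed.

Lemma measurable_normc_horner (Q : {poly R[i]}) :
  measurable_fun setT (fun z => normc Q.[z]).
Proof.
suff [] : measurable_fun setT (fun z => complex.Re Q.[z]) /\
    measurable_fun setT (fun z => complex.Im Q.[z]).
  exact: measurable_normc_ReIm.
elim/poly_ind: Q => [|Q c [QRe QIm]].
  by split; under eq_fun do rewrite horner0 /=; exact: measurable_cst.
have cRe := measurable_Re; have cIm := measurable_Im.
split.
  rewrite (_ : (fun z => _) = fun z => complex.Re Q.[z] * complex.Re z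
      - complex.Im Q.[z] * complex.Im z + complex.Re c).
    apply: measurable_funD => //.
    by apply: measurable_funB; apply: measurable_funM.
  apply/funext => z; rewrite hornerMXaddC.
  by case: c z Q.[z] => [? ?] [? ?] [? ?].
rewrite (_ : (fun z => _) = fun z => complex.Re Q.[z] * complex.Im z
    + complex.Im Q.[z] * complex.Re z + complex.Im c).
  apply: measurable_funD => //.
  by apply: measurable_funD; apply: measurable_funM.
apply/funext => z; rewrite hornerMXaddC.
by case: c z Q.[z] => [? ?] [? ?] [? ?].
Qed.

(** Extending a nonnegative function by 0 outside a closed set preserves upper
    semicontinuity.  The value 0 has a second use: the potential of the extended
    weight is [+oo] outside [Sigma], so lower bounds hold on the whole plane. *)
Lemma patch_upper_semicontinuous (Sigma : set R[i]) (w : R[i] -> R) :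
  closed Sigma -> (forall z, Sigma z -> 0 <= w z) ->
  (forall z a, Sigma z -> w z < a ->
     \forall y \near within Sigma (nbhs z), w y < a) ->
  forall a, open [set z | (w \_ Sigma) z < a].
Proof.
move=> cS w0 wusc a; have [a0|a0] := leP a 0.
  rewrite (_ : mkset _ = set0); first exact: open0.
  apply/seteqP; split => z //=; rewrite patchE.
  case: ifPn => [/set_mem zS|_] za; last by move: za; rewrite ltNge a0.
  by move: (lt_le_trans za a0); rewrite ltNge w0.
apply/openP_normc => z /= za.
have [zS|zS] := pselect (Sigma z).
  have wza : w z < a by move: za; rewrite patchE mem_set.
  have /nbhs_normc[e e0 h] := wusc _ _ zS wza.
  exists e => // y /h {}h; rewrite patchE; case: ifPn => // /set_mem; exact: h.
have : open (~` Sigma) by exact: closed_openC.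
move=> /openP_normc/(_ z zS)[e e0 h]; exists e => // y /h yS.
by rewrite patchE memNset.
Qed.

End borel.

(** * Moving a root of an optimal polynomial *)

(** From e^(cn) >= 1 + cn one gets |C| e^(-cn) < 1 - r once
    |C| < (1 - r) c n. *)
Lemma localization_factor_small (R : realType) (r c C : R) :
  0 <= r < 1 -> 0 < c ->
  exists n1 : nat, forall n : nat, (n1 < n)%N ->
    (1 + C * expR (- (c * n%:R))) * r < 1.
Proof.
move=> /andP[r0 r1] c0.
have rc0 : 0 < (1 - r) * c by apply: mulr_gt0 => //; lra.
exists (Num.truncn (`|C| / ((1 - r) * c))) => n.
rewrite truncn_lt_nat; last by rewrite divr_ge0// ltW.
rewrite ltr_pdivrMr// => Cn.
set e := expR _; have e0 : 0 < e by exact: expR_gt0.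
have e1 : e * (1 + c * n%:R) <= 1.
  rewrite /e expRN mulrC ler_pdivrMr ?expR_gt0// mul1r.
  exact: expR_ge1Dx.
have Ce : `|C| * e < 1 - r.
  have : n%:R * ((1 - r) * c) * e <= 1 - r.
    have -> : n%:R * ((1 - r) * c) * e
        = (1 - r) * (e * (1 + c * n%:R)) - (1 - r) * e by ring.
    have : 0 <= (1 - r) * e by apply: mulr_ge0; lra.
    have : (1 - r) * (e * (1 + c * n%:R)) <= (1 - r) * 1.
      by apply: ler_wpM2l => //; lra.
    lra.
  by apply: lt_le_trans; rewrite ltr_pM2r.
have : C * e <= `|C| * e by rewrite ler_wpM2r ?ler_norm// ltW.
have : C * e * r <= `|C| * e * r by rewrite !ler_wpM2r ?ler_norm// ltW.
have : `|C| * e * r <= `|C| * e by rewrite ler_piMr ?mulr_ge0// ltW.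
rewrite mulrDl mul1r; lra.
Qed.

Section roots.
Context {R : realType}.
Context (Sigma : set R[i]) (sigma : {measure set R[i] -> \bar R}).
Context (w : R[i] -> R) (p : R).
Hypotheses (cSigma : closed Sigma) (mw : measurable_fun Sigma w) (p0 : 0 < p).
Local Open Scope ereal_scope.
Local Notation wi := (weighted_integral sigma w p).

Let p1 : (p^-1 != 0)%R. Proof. by rewrite invr_eq0 gt_eqF. Qed.

Lemma weighted_integral_ge0 A n Q : 0 <= wi A n Q.
Proof. by apply: integral_ge0 => z _; rewrite lee_fin mulr_ge0// powR_ge0. Qed.

Lemma weighted_norm_gt0_lty n Q : 0 < weighted_norm Sigma sigma w p n Q < +oo ->
  0 < wi Sigma n Q < +oo.
Proof.
move=> /andP[h1 h2]; apply/andP; split; last exact: lty_poweRy h2.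
by apply: gt0_poweR h1; rewrite ?invr_gt0//; exact: weighted_integral_ge0.
Qed.

Lemma le_weighted_norm n P Q :
  weighted_norm Sigma sigma w p n P <= weighted_norm Sigma sigma w p n Q ->
  wi Sigma n P <= wi Sigma n Q.
Proof.
have E X : 0 <= X -> (X `^ p^-1) `^ p = X.
  by move=> X0; rewrite -poweRrM mulVf ?gt_eqF// poweRe1.
move=> PQ; rewrite -(E _ (weighted_integral_ge0 Sigma n P)).
rewrite -(E _ (weighted_integral_ge0 Sigma n Q)).
by apply: gt0_ler_poweR => //; rewrite ?ltW// in_itv/= poweR_ge0 leey.
Qed.

Lemma measurable_weighted_integrand n (Q : {poly R[i]}) A :
  measurable A -> A `<=` Sigma ->
  measurable_fun A
    (EFin \o (fun z : R[i] => normc Q.[z] `^ p * w z `^ (n%:R * p))%R).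
Proof.
move=> mA AS; apply/measurable_EFinP; apply: measurable_funM.
  apply: (@measurableT_comp _ _ _ _ _ _ (fun x : R => (x `^ p)%R)).
    exact: measurable_powR.
  by apply: measurable_funTS; exact: measurable_normc_horner.
apply: (@measurableT_comp _ _ _ _ _ _ (fun x : R => (x `^ (n%:R * p))%R)).
  exact: measurable_powR.
by apply: measurable_funS mw => //; exact: closed_measurableC.
Qed.

Lemma le_weighted_integral A n (P Q : {poly R[i]}) (rho : R) : measurable A ->
  A `<=` Sigma -> (0 <= rho)%R ->
  (forall z, A z -> (normc Q.[z] <= rho * normc P.[z])%R) ->
  wi A n Q <= (rho `^ p)%:E * wi A n P.
Proof.
move=> mA AS rho0 QP.
have mI := measurable_weighted_integrand n _ A mA AS.
rewrite /weighted_integral -ge0_integralZl//; first last.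
- by rewrite lee_fin powR_ge0.
- by move=> z _; rewrite lee_fin mulr_ge0// powR_ge0.
- exact: mI.
apply: ge0_le_integral => //.
- by move=> z _; rewrite lee_fin mulr_ge0// powR_ge0.
- exact: mI.
- by apply: measurable_funeM; exact: mI.
move=> z Az; rewrite -EFinM lee_fin mulrA ler_wpM2r ?powR_ge0//.
rewrite -powRM ?normc_ge0//.
apply: ge0_ler_powR; rewrite ?nnegrE ?mulr_ge0 ?normc_ge0//; first exact: ltW.
exact: QP.
Qed.

Lemma weighted_integral_subset A n Q : measurable A -> A `<=` Sigma ->
  wi A n Q <= wi Sigma n Q.
Proof.
move=> mA AS; have mS := closed_measurableC _ cSigma.
apply: ge0_subset_integral => //; first exact: measurable_weighted_integrand.
by move=> z _; rewrite lee_fin mulr_ge0// powR_ge0.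
Qed.

(** If [S] were empty, localization could be applied to the empty neighbourhood
    and would give the constant polynomial 1 a zero weighted integral, against
    well-posedness. *)
Lemma localization_neq0 (S : set R[i]) : well_posed Sigma sigma w p ->
  localization Sigma sigma w p S -> S !=set0.
Proof.
move=> wp loc; apply/set0P/eqP => S0.
have [||c [C [c0 h]]] := loc set0 open0.
- by apply: bounded_normc; exists 0%R.
- by rewrite S0.
have := h 1%N 1%R isT; rewrite size_poly1 => /(_ isT).
have /weighted_norm_gt0_lty/andP[i0 _] :
    0 < weighted_norm Sigma sigma w p 1 1 < +oo.
  by apply: wp => //; rewrite ?oner_neq0// size_poly1.
rewrite set0I [X in _ * X]/weighted_integral integral_set0 mule0.
by rewrite leNgt i0.
Qed.

(** Replacing the root [z0] by its projection [z1] lowers the weighted integral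
    for large degrees, so an optimal polynomial cannot vanish at [z0]. *)
Lemma optimal_poly_no_root (S : set R[i]) (P : nat -> {poly R[i]}) :
  (exists M : R, forall z, S z -> (normc z <= M)%R) ->
  well_posed Sigma sigma w p -> localization Sigma sigma w p S ->
  (forall n : nat, (0 < n)%N -> optimal_poly Sigma sigma w p n (P n)) ->
  forall K : set R[i], closed K -> K `<=` ~` closed_convex_hull S ->
  exists n1 : nat, forall n : nat, (n1 < n)%N ->
    forall z : R[i], K z -> ~~ root (P n) z.
Proof.
move=> [M SM] wp loc opt K cK KS.
set Co := closed_convex_hull S in KS.
have CoM := closed_convex_hull_bounded S M SM.
have cptCo : compact Co.
  by apply: closed_normc_compact; [exact: closed_convex_hull_closed|exists M].
have Co0 : Co !=set0.
  have [x Sx] := localization_neq0 _ wp loc.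
  by exists x; exact: closed_convex_hull_sub.
have [d d0 dKCo] := closed_compact_dist K Co cK cptCo KS.
have [rho /andP[rho0 rho1] contr] := projection_contracts Co M d Co0 cptCo
  (closed_convex_hull_convex S) CoM d0.
pose N := neighbourhood Co (d / 4).
have [||c [C [c0 locN]]] := loc N (neighbourhood_open _ _).
- by apply: bounded_normc; exists (M + d / 4)%R; exact: neighbourhood_bounded.
- apply: subset_trans (closed_convex_hull_sub S) _.
  by apply: sub_neighbourhood; exact: divr_gt0.
have rp : (0 <= rho `^ p < 1)%R.
  rewrite powR_ge0 /=.
  have := @gt0_ltr_powR _ _ p0 rho 1%R; rewrite powR1; apply => //.
  by rewrite nnegrE.
(* C may be negative: its absolute value keeps the factor nonnegative, as the
   chain of inequalities below multiplies by it. *)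
have [n1 n1P] := localization_factor_small _ _ c `|C|%R rp c0.
exists n1 => n n1n z0 Kz0; apply/negP => /factor_theorem[q Pq].
have n0 : (0 < n)%N by exact: leq_ltn_trans n1n.
have [Pmon Psz Popt] := opt n n0.
have [z1 z1P] := contr z0 (fun y => dKCo z0 y Kz0).
have qmon : q \is monic.
  by move: Pmon; rewrite Pq monicMr// monicXsubC.
pose Q := (q * ('X - z1%:P))%R.
have Qmon : Q \is monic by rewrite rpredM// monicXsubC.
have Qsz : size Q = n.+1.
  by rewrite -Psz Pq /Q !size_Mmonic ?monicXsubC ?monic_neq0// !size_XsubC.
have mN : measurable (N `&` Sigma).
  apply: measurableI; last exact: closed_measurableC.
  by apply: open_measurableC; exact: neighbourhood_open.
have NS : N `&` Sigma `<=` Sigma by exact: subIsetr.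
have PQ : wi Sigma n (P n) <= wi Sigma n Q.
  by apply: le_weighted_norm; exact: Popt.
have /weighted_norm_gt0_lty/andP[P0 Poo] :
    0 < weighted_norm Sigma sigma w p n (P n) < +oo.
  by apply: wp => //; rewrite ?Psz// monic_neq0.
have QN : wi (N `&` Sigma) n Q <= (rho `^ p)%:E * wi Sigma n (P n).
  apply: (@le_trans _ _ ((rho `^ p)%:E * wi (N `&` Sigma) n (P n))).
    apply: le_weighted_integral => // z [Nz _].
    rewrite Pq /Q !hornerM !hornerXsubC !normcM mulrCA ler_wpM2l ?normc_ge0//.
    exact: z1P.
  apply: lee_wpmul2l; first by rewrite lee_fin powR_ge0.
  exact: weighted_integral_subset.
have := locN n Q n0; rewrite Qsz leqnn => /(_ isT).
apply/negP; rewrite -ltNge; apply: lt_le_trans PQ.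
apply: (@le_lt_trans _ _ ((1 + `|C| * expR (- (c * n%:R)))%R%:E *
    wi (N `&` Sigma) n Q)).
  apply: lee_wpmul2r; first exact: weighted_integral_ge0.
  by rewrite lee_fin lerD2l ler_wpM2r ?expR_ge0// ler_norm.
apply: (@le_lt_trans _ _ ((1 + `|C| * expR (- (c * n%:R)))%R%:E *
    ((rho `^ p)%:E * wi Sigma n (P n)))).
  apply: lee_wpmul2l; last exact: QN.
  by rewrite lee_fin addr_ge0// mulr_ge0// expR_ge0.
rewrite muleA -EFinM -(@fineK _ (wi Sigma n (P n))); last first.
  by rewrite ge0_fin_numE// ltW.
rewrite -EFinM lte_fin gtr_pMl; first exact: n1P.
by rewrite fine_gt0// P0.
Qed.

End roots.

(** * Conditional probabilities and integrals *)

Section integrals.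
Local Open Scope ereal_scope.
Context {d} {T : measurableType d} {R : realType}.

Lemma mule_lty_cancel (a x : \bar R) : 0 < a -> a * x < +oo -> x < +oo.
Proof.
by move=> a0; case: x => [r| |]; rewrite ?ltry ?ltNyr// gt0_muley.
Qed.

Lemma integral_full_set (m : {measure set T -> \bar R}) (D : set T)
    (f : T -> \bar R) : measurable D -> measurable_fun setT f ->
  m (~` D) = 0 -> \int[m]_(x in D) f x = \int[m]_x f x.
Proof.
move=> mD mf D0; rewrite integral_mkcond; apply: ae_eq_integral => //.
  by apply/(measurable_restrictT _ mD); exact: measurable_funTS.
exists (~` D); split=> //; first exact: measurableC.
move=> x /= /not_implyP[_ h] Dx; apply: h.
by rewrite patchE mem_set.
Qed.

(** The negative part of [f] is at most [g], hence integrable; so the integral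
    of [f] is no indeterminate form, and if it is not [+oo] then the positive
    part is integrable as well. *)
Lemma integrable_of_lower_bound (m : {measure set T -> \bar R})
    (f : T -> \bar R) (g : T -> R) : measurable_fun setT f ->
  measurable_fun setT g -> (forall x, (0 <= g x)%R) ->
  (forall x, - (g x)%:E <= f x) ->
  \int[m]_x (g x)%:E < +oo -> \int[m]_x f x < +oo -> m.-integrable setT f.
Proof.
move=> mf mg g0 gf ig.
have mfp := measurable_funepos mf.
have mfn := measurable_funeneg mf.
have nf : \int[m]_x f^\- x < +oo.
  apply: le_lt_trans ig; apply: ge0_le_integral => //.
    exact/measurable_EFinP.
  by move=> x _; rewrite funenegE ge_max lee_fin g0 andbT leeNl.
rewrite integralE => pf; apply/integrableP; split => //.
under eq_integral do rewrite -/((abse \o f) _) fune_abse.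
rewrite ge0_integralD// lte_add_pinfty//.
move: pf; have : 0 <= \int[m]_x f^\- x by apply: integral_ge0.
case: (\int[m]_x f^\- x) nf => // r _ _.
by case: (\int[m]_x f^\+ x) => [s|//|] _; rewrite ?ltry ?ltNyr.
Qed.

(** A relational form of [nu A = P (A `&` D) / P D] that avoids the division of
    extended reals. *)
Definition conditioned (P : probability T R) (D : set T)
    (nu : probability T R) :=
  forall A, measurable A -> P D * nu A = P (A `&` D).

Lemma exists_conditioned (P : probability T R) (D : set T) : measurable D ->
  0 < P D -> exists nu : probability T R, conditioned P D nu.
Proof.
move=> mD D0; exists (mnormalize (mrestr P mD) P : probability T R) => A mA.
have Doo : P D \is a fin_num by exact: fin_num_measure.
have E : (mrestr P mD : {measure set T -> \bar R}) setT = P D.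
  by rewrite /= /mrestr setTI.
rewrite /= /mnormalize E gt_eqF//= ifF; last first.
  by apply/negbTE; move: Doo; case: (P D).
rewrite /mrestr muleCA -[X in _ * (X * _)]fineK// -EFinM divff ?mule1//.
by rewrite gt_eqF// fine_gt0// D0 ltey_eq Doo.
Qed.

Lemma conditioned_integral (P : probability T R) (D : set T) nu
    (f : T -> \bar R) :
  measurable D -> 0 < P D -> conditioned P D nu ->
  measurable_fun setT f -> (forall x, 0 <= f x) ->
  P D * \int[nu]_x f x = \int[P]_(x in D) f x.
Proof.
move=> mD D0 nuP mf f0.
have Doo : P D \is a fin_num by exact: fin_num_measure.
have d0 : (0 < fine (P D))%R by rewrite fine_gt0// D0 ltey_eq Doo.
have nuD : nu (~` D) = 0.
  have := nuP _ (measurableC mD); rewrite setICl measure0 => /eqP.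
  by rewrite mule_eq0 gt_eqF//= => /eqP.
rewrite -(integral_full_set _ _ _ mD mf nuD).
rewrite -[P D]fineK//.
rewrite -(@ge0_integral_mscale _ _ _ nu D mD (NngNum (ltW d0)))//; last first.
  exact: measurable_funTS.
apply: eq_measure_integral => A mA AD.
rewrite [LHS](_ : _ = (fine (P D))%:E * nu A)// fineK//.
by rewrite nuP// setIidl.
Qed.

Lemma conditioned_integral_le (P : probability T R) (D : set T) nu
    (f : T -> \bar R) :
  measurable D -> 0 < P D -> conditioned P D nu ->
  measurable_fun setT f -> (forall x, 0 <= f x) ->
  P D * \int[nu]_x f x <= \int[P]_x f x.
Proof.
move=> mD D0 nuP mf f0; rewrite (conditioned_integral P D)//.
exact: ge0_subset_integral.
Qed.

(** By Tonelli's theorem, [conditioned_integral_le] can be used once in each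
    variable. *)
Lemma conditioned_integral2_le (P : probability T R) (D : set T) nu
    (f : T * T -> \bar R) :
  measurable D -> 0 < P D -> conditioned P D nu ->
  measurable_fun setT f -> (forall x, 0 <= f x) ->
  P D * (P D * \int[nu \x nu]_x f x) <= \int[P \x P]_x f x.
Proof.
move=> mD D0 nuP mf f0; rewrite !fubini_tonelli1//.
have mF := measurable_fun_fubini_tonelli_F (m2 := nu) f mf f0.
have mG := measurable_fun_fubini_tonelli_F (m2 := P) f mf f0.
have D0' := ltW D0.
apply: (@le_trans _ _ (P D * \int[P]_x fubini_F nu f x)).
  apply: lee_wpmul2l => //; apply: (conditioned_integral_le P D) => //.
  by move=> x; apply: integral_ge0.
rewrite -ge0_integralZl//; last by move=> x _; apply: integral_ge0.
apply: ge0_le_integral => //.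
- by move=> x _; apply: mule_ge0 => //; apply: integral_ge0.
- exact: emeasurable_funM.
move=> x _; apply: (conditioned_integral_le P D) => //.
exact: measurable_fun_pair2.
Qed.

Lemma integral_product_fst (P : probability T R) (f : T -> \bar R) :
  measurable_fun setT f -> (forall x, 0 <= f x) ->
  \int[P \x P]_x f x.1 = \int[P]_x f x.
Proof.
move=> mf f0; rewrite fubini_tonelli1//; last first.
  exact: measurableT_comp.
apply: eq_integral => x _; rewrite /fubini_F /= integral_cst//.
by rewrite [X in _ * X]probability_setT mule1.
Qed.

Lemma integral_product_snd (P : probability T R) (f : T -> \bar R) :
  measurable_fun setT f -> (forall x, 0 <= f x) ->
  \int[P \x P]_x f x.2 = \int[P]_x f x.
Proof.
move=> mf f0; rewrite fubini_tonelli2//; last first.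
  exact: measurableT_comp.
apply: eq_integral => x _; rewrite /fubini_G /= integral_cst//.
by rewrite [X in _ * X]probability_setT mule1.
Qed.

Lemma probability_eq1_setC (P : probability T R) (A : set T) :
  measurable A -> P A = 1 -> P (~` A) = 0.
Proof. by move=> mA A1; rewrite probability_setC// A1 subee. Qed.

End integrals.

(** * Growth of an admissible weight *)

Section admissible_weight.
Context {R : realType} (Sigma : set R[i]) (w : R[i] -> R).
Hypotheses (cS : closed Sigma) (adm : admissible Sigma w).
Local Notation v := (w \_ Sigma).

Lemma patch_weight_ge0 z : 0 <= v z.
Proof.
have [w0 _ _ _] := adm.
by rewrite patchE; case: ifPn => // /set_mem; exact: w0.
Qed.

Lemma patch_weight_usc a : open [set z | v z < a].
Proof. by have [w0 wusc _ _] := adm; exact: patch_upper_semicontinuous. Qed.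

(** As soon as |z| >= 1, the factor 1 + |z| is at most 2 |z|. *)
Lemma patch_weight_decay (e : R) : 0 < e ->
  exists M : R, forall z, M < normc z -> v z * (1 + normc z) < e.
Proof.
move=> e0; have [w0 _ _ /(_ (e / 2))[]] := adm; first exact: divr_gt0.
move=> M hM; exists (Num.max M 1) => z; rewrite gt_max => /andP[Mz z1].
rewrite patchE; case: ifPn => [/set_mem zS|_]; last by rewrite mul0r.
have := hM z zS Mz; rewrite ltr_pdivlMr// => h.
apply: le_lt_trans h; have -> : normc z * w z * 2 = w z * (2 * normc z) by ring.
by apply: ler_wpM2l; [exact: w0|lra].
Qed.

(** At infinity the product is small; on the remaining disk the weight is upper
    semicontinuous, hence bounded above by compactness. *)
Lemma patch_weight_bounded :
  exists2 B : R, 0 < B & forall z, v z * (1 + normc z) <= B.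
Proof.
have [M hM] := patch_weight_decay _ ltr01.
have cpt : compact [set z : R[i] | normc z <= M].
  by apply: closed_normc_compact; [exact: closed_normc_le|exists M].
have /compact_near_coveringP := cpt.
move=> /(_ R +oo (fun b z => v z < b) _)[|b [_ hb]].
  move=> z _; exists ([set y | v y < v z + 1], [set b | v z + 1 < b]).
    split => /=.
      apply: open_nbhs_nbhs; split; first exact: patch_weight_usc.
      by rewrite /= ltrDl.
    by exists (v z + 1); split; rewrite ?num_real.
  by move=> [y b] /= [h1 h2]; exact: lt_trans h2.
have bP z : normc z <= M -> v z <= `|b| + 1.
  move=> zM; apply: ltW; apply: (hb (`|b| + 1)) => //.
  by apply: le_lt_trans (ler_norm b) _; rewrite ltrDl.
exists (1 + (`|b| + 1) * (1 + `|M|)).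
  by rewrite ltr_pwDl// mulr_ge0// addr_ge0.
move=> z; have [zM|zM] := leP (normc z) M.
  rewrite -[leLHS]add0r lerD// ler_pM ?patch_weight_ge0 ?addr_ge0 ?normc_ge0//.
    exact: bP.
  by rewrite lerD2l (le_trans zM)// ler_norm.
apply: (le_trans (ltW (hM z zM))).
by rewrite lerDl mulr_ge0// addr_ge0.
Qed.

End admissible_weight.

(** * The logarithmic kernel *)

Section kernels.
Context {R : realType}.
Local Open Scope ereal_scope.

Definition log1n (z : R[i]) : R := ln (1 + normc z)%R.

Lemma log1n_ge0 z : (0 <= log1n z)%R.
Proof. by rewrite /log1n ln_ge0// lerDl normc_ge0. Qed.

Lemma measurable_normc : measurable_fun setT (fun z : R[i] => normc z).
Proof. by apply: continuous_measurableC; exact: continuous_normc. Qed.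

Lemma measurable_log1n : measurable_fun setT log1n.
Proof.
apply: (@measurableT_comp _ _ _ _ _ _ (@ln R)); first exact: measurable_ln.
by apply: measurable_funD => //; exact: measurable_normc.
Qed.

Lemma measurable_lne d (T : measurableType d) (f : T -> R) :
  measurable_fun setT f -> (forall t, 0 <= f t)%R ->
  measurable_fun setT (fun t => lne (f t)%:E).
Proof.
move=> mf f0.
rewrite (_ : (fun t => _) =
    fun t => if (f t == 0)%R then -oo else (ln (f t))%:E); last first.
  by apply/funext => t /=; rewrite eq_le f0 andbT.
apply: measurable_fun_ifT => //.
  by apply: measurable_fun_eqr => //; exact: measurable_cst.
by apply/measurable_EFinP; apply: measurableT_comp mf; exact: measurable_ln.
Qed.

Definition log_kernel (x : R[i] * R[i]) : \bar R :=
  - lne (normc (x.1 - x.2))%:E.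

Lemma measurable_log_kernel : measurable_fun setT log_kernel.
Proof.
have m1 := @measurable_fst _ _ R[i] R[i].
have m2 := @measurable_snd _ _ R[i] R[i].
apply: measurableT_comp => //; apply: measurable_lne; last first.
  by move=> t; exact: normc_ge0.
apply: measurable_normc_ReIm.
  rewrite (_ : (fun t => _) =
      fun t : R[i] * R[i] => (complex.Re t.1 - complex.Re t.2)%R).
    by apply: measurable_funB; apply: (measurableT_comp measurable_Re).
  by apply/funext => -[[? ?] [? ?]].
rewrite (_ : (fun t => _) =
    fun t : R[i] * R[i] => (complex.Im t.1 - complex.Im t.2)%R).
  by apply: measurable_funB; apply: (measurableT_comp measurable_Im).
by apply/funext => -[[? ?] [? ?]].
Qed.

(** This is |z - t| <= |z| + |t| <= (1 + |z|) (1 + |t|). *)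
Lemma log_kernel_ge x : - (log1n x.1 + log1n x.2)%:E <= log_kernel x.
Proof.
rewrite /log_kernel leeN2 /lne; case: ifPn; first by rewrite leNye.
rewrite -ltNge => x0; rewrite lee_fin -lnM ?posrE ?ltr_pwDl ?normc_ge0//.
rewrite ler_ln ?posrE ?mulr_gt0 ?ltr_pwDl ?normc_ge0//.
apply: le_trans (le_normcD _ _) _; rewrite normcN.
have := normc_ge0 x.1; have := normc_ge0 x.2; nra.
Qed.

End kernels.

(** * Weighted energy as a sum of nonnegative terms *)

Section energy.
Context {R : realType} (Sigma : set R[i]) (w : R[i] -> R) (B : R).
Hypotheses (cS : closed Sigma) (adm : admissible Sigma w).
Local Notation v := (w \_ Sigma).
Hypotheses (B0 : 0 < B) (vB : forall z, v z * (1 + normc z) <= B).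
Local Open Scope ereal_scope.
Local Notation l := (@log1n R).

Definition pair_kernel (x : R[i] * R[i]) : \bar R :=
  log_kernel x + (l x.1 + l x.2)%:E.

(** With V the potential of the weight, this is V - ln(1 + |z|) + ln B, written
    as a single logarithm so that it makes sense where the weight vanishes. *)
Definition reduced_potential (z : R[i]) : \bar R :=
  - lne (v z * (1 + normc z) / B)%:E.

Local Notation kk := pair_kernel.
Local Notation H := reduced_potential.

Lemma pair_kernel_ge0 x : 0 <= kk x.
Proof. by rewrite /kk -leeBlDr// sub0e; exact: log_kernel_ge. Qed.

Lemma measurable_pair_kernel : measurable_fun setT kk.
Proof.
apply: emeasurable_funD; first exact: measurable_log_kernel.
apply/measurable_EFinP; apply: measurable_funD.
  exact: (measurableT_comp measurable_log1n).
exact: (measurableT_comp measurable_log1n).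
Qed.

Let u_ge0 z : (0 <= v z * (1 + normc z) / B)%R.
Proof.
rewrite divr_ge0 ?mulr_ge0 ?patch_weight_ge0 ?addr_ge0 ?normc_ge0 ?ltW//.
Qed.

Lemma reduced_potential_ge0 z : 0 <= H z.
Proof.
rewrite /H oppe_ge0 lne_le0 lee_fin ler_pdivrMr// mul1r; exact: vB.
Qed.

Lemma reduced_potential_ge (L : R) z :
  (v z * (1 + normc z) <= B * expR (- L))%R -> L%:E <= H z.
Proof.
move=> h; rewrite /H leeNr -[- _]/((- L)%:E).
rewrite -[leRHS]expeRK lee_lne ?in_itv/= ?leey ?lee_fin ?expR_ge0 ?u_ge0//.
by rewrite ler_pdivrMr// [leRHS]mulrC.
Qed.

Lemma reduced_potential_le (t : R) z : (0 < t)%R -> (t <= v z)%R ->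
  H z <= (- ln (t / B))%:E.
Proof.
move=> t0 tv; rewrite /H EFinN leeN2 -lne_EFin ?divr_gt0//.
rewrite lee_lne ?in_itv/= ?leey ?lee_fin ?u_ge0 ?(ltW (divr_gt0 t0 B0))//.
rewrite ler_pM2r ?invr_gt0// (le_trans tv)// ler_peMr ?patch_weight_ge0//.
by rewrite lerDl normc_ge0.
Qed.

Lemma measurable_patch_weight : measurable_fun setT v.
Proof. by apply: usc_measurable; exact: patch_weight_usc. Qed.

Lemma measurable_reduced_potential : measurable_fun setT H.
Proof.
apply: measurableT_comp => //; apply: measurable_lne; last exact: u_ge0.
apply: measurable_funM => //; apply: measurable_funM.
  exact: measurable_patch_weight.
by apply: measurable_funD => //; exact: measurable_normc.
Qed.

Lemma potential_reduced z : potential v z = H z + (l z - ln B)%:E.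
Proof.
rewrite /potential /H.
have z1 : (0 < 1 + normc z)%R by rewrite ltr_pwDl ?normc_ge0.
have [v0|v0] := eqVneq (v z) 0%R; first by rewrite v0 !mul0r /= lexx.
have {}v0 : (0 < v z)%R by rewrite lt_neqAle eq_sym v0 patch_weight_ge0.
rewrite !lne_EFin ?divr_gt0 ?mulr_gt0// ln_div ?posrE ?mulr_gt0// lnM ?posrE//.
by rewrite /log1n -!EFinN -EFinD; congr EFin; ring.
Qed.

Lemma measurable_potential : measurable_fun setT (potential v).
Proof.
apply: measurableT_comp => //; apply: measurable_lne; last first.
  exact: patch_weight_ge0.
exact: measurable_patch_weight.
Qed.

Lemma integral_potential (nu : probability R[i] R) : nu Sigma = 1 ->
  \int[nu]_(z in Sigma) potential w z = \int[nu]_z potential v z.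
Proof.
move=> nuS; have mS := closed_measurableC _ cS.
rewrite -(integral_full_set nu Sigma)//; last 2 first.
- exact: measurable_potential.
- exact: probability_eq1_setC.
by apply: eq_integral => z zS; rewrite /potential patchE zS.
Qed.

Definition finite_energy (nu : probability R[i] R) :=
  [/\ \int[nu]_z (l z)%:E < +oo, \int[nu]_z H z < +oo &
      \int[nu \x nu]_x kk x < +oo].

Lemma measurable_EFin_log1n : measurable_fun setT (EFin \o l).
Proof. by apply/measurable_EFinP; exact: measurable_log1n. Qed.

Lemma integrable_log1n (nu : probability R[i] R) : \int[nu]_z (l z)%:E < +oo ->
  nu.-integrable setT (EFin \o l).
Proof.
move=> h; apply/integrableP; split; first exact: measurable_EFin_log1n.
by under eq_integral do rewrite /= ger0_norm ?log1n_ge0//.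
Qed.

Lemma integral_log1n2 (nu : probability R[i] R) :
  \int[nu \x nu]_x (l x.1 + l x.2)%:E = 2%:E * \int[nu]_z (l z)%:E.
Proof.
under eq_integral do rewrite EFinD.
rewrite ge0_integralD//; first last.
- by apply: (measurableT_comp measurable_EFin_log1n).
- by move=> x _; rewrite lee_fin log1n_ge0.
- by apply: (measurableT_comp measurable_EFin_log1n).
- by move=> x _; rewrite lee_fin log1n_ge0.
rewrite (integral_product_fst _ (EFin \o l) measurable_EFin_log1n); last first.
  by move=> x; rewrite lee_fin log1n_ge0.
rewrite (integral_product_snd _ (EFin \o l) measurable_EFin_log1n); last first.
  by move=> x; rewrite lee_fin log1n_ge0.
by rewrite -mule2n muleC mule_natr.
Qed.

(** The logarithmic kernel is bounded below by the integrable function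
    - l(z) - l(t), so an energy that is not [+oo] is a true integral. *)
Lemma pair_kernel_lty (nu : probability R[i] R) :
  \int[nu]_z (l z)%:E < +oo -> log_energy nu < +oo ->
  \int[nu \x nu]_x kk x < +oo.
Proof.
move=> lf kf.
have l2 : \int[nu \x nu]_x (l x.1 + l x.2)%:E < +oo.
  by rewrite integral_log1n2 lte_mul_pinfty// lee_fin.
have ml2 : measurable_fun setT (fun x : R[i] * R[i] => l x.1 + l x.2)%R.
  by apply: measurable_funD; apply: (measurableT_comp measurable_log1n).
have l20 (x : R[i] * R[i]) : (0 <= l x.1 + l x.2)%R.
  by rewrite addr_ge0 ?log1n_ge0.
have ik : (nu \x nu).-integrable setT log_kernel.
  apply: (integrable_of_lower_bound _ _ _ measurable_log_kernel ml2 l20) => //.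
  exact: log_kernel_ge.
have il : (nu \x nu).-integrable setT (fun x => (l x.1 + l x.2)%:E).
  apply/integrableP; split; first exact/measurable_EFinP.
  by under eq_integral do rewrite /= ger0_norm ?l20//.
have := integrableD measurableT ik il => /integrableP[_].
under eq_integral do rewrite gee0_abs ?pair_kernel_ge0//.
by [].
Qed.

(** A dual sum that is not [+oo] has no term equal to [+oo].  The potential is
    H + l - ln B with H and l nonnegative, so its integral controls those of H
    and of l; once l is integrable, [pair_kernel_lty] controls the logarithmic
    part. *)
Lemma finite_energyP (nu : probability R[i] R) : nu Sigma = 1 ->
  weighted_energy Sigma w nu < +oo -> finite_energy nu.
Proof.
move=> nuS; rewrite /weighted_energy integral_potential// => wf.
have [kf Vf] : log_energy nu < +oo /\ 2%:E * \int[nu]_z potential v z < +oo.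
  move: wf; rewrite /dual_adde.
  case: (log_energy nu) => [?||]; case: (2%:E * _) => [?||] //= _;
    by rewrite ?ltry ?ltNyr.
have {}Vf : \int[nu]_z potential v z < +oo.
  by apply: (mule_lty_cancel _ _ _ Vf); rewrite lte_fin.
have iV : nu.-integrable setT (potential v).
  apply: (integrable_of_lower_bound _ _ (cst `|ln B|%R)) => //=.
  - exact: measurable_potential.
  - move=> z; rewrite potential_reduced.
    apply: (@le_trans _ _ (0 + (l z - ln B)%:E)); last first.
      by apply: leeD => //; exact: reduced_potential_ge0.
    rewrite add0e lee_fin; have := log1n_ge0 z; have := ler_norm (ln B); lra.
  - by rewrite integral_cst//= probability_setT mule1 ltry.
have iVB : nu.-integrable setT (fun z => potential v z + (ln B)%:E).
  apply: integrableD => //; exact: finite_measure_integrable_cst.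
have E z : potential v z + (ln B)%:E = H z + (l z)%:E.
  by rewrite potential_reduced -addeA -EFinD subrK.
have Hl : \int[nu]_z (H z + (l z)%:E) < +oo.
  move/integrableP : iVB => [_].
  under eq_integral do rewrite E gee0_abs
    ?adde_ge0 ?reduced_potential_ge0 ?lee_fin ?log1n_ge0//.
  by [].
have mHz := measurable_reduced_potential.
have lf : \int[nu]_z (l z)%:E < +oo.
  apply: le_lt_trans Hl; apply: ge0_le_integral => //.
  - by move=> z _; rewrite lee_fin log1n_ge0.
  - exact: measurable_EFin_log1n.
  - by apply: emeasurable_funD => //; exact: measurable_EFin_log1n.
  - by move=> z _; rewrite leeDr// reduced_potential_ge0.
split => //; last exact: pair_kernel_lty.
apply: le_lt_trans Hl; apply: ge0_le_integral => //.
- by move=> z _; exact: reduced_potential_ge0.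
- by apply: emeasurable_funD => //; exact: measurable_EFin_log1n.
- by move=> z _; rewrite leeDl// lee_fin log1n_ge0.
Qed.

Definition reduced_energy (nu : probability R[i] R) : \bar R :=
  \int[nu \x nu]_x kk x + 2%:E * \int[nu]_z H z.

(** All the integrals are finite, and the terms l(z) + l(t) of the double
    integral cancel the terms l of the two potentials. *)
Lemma weighted_energyE (nu : probability R[i] R) : nu Sigma = 1 ->
  finite_energy nu ->
  weighted_energy Sigma w nu = reduced_energy nu - (2 * ln B)%:E.
Proof.
move=> nuS [lf Hf kf]; rewrite /weighted_energy integral_potential//.
have il := integrable_log1n _ lf.
have l2f : \int[nu \x nu]_x (l x.1 + l x.2)%:E < +oo.
  by rewrite integral_log1n2 lte_mul_pinfty// lee_fin.
have ml2 : measurable_fun setT (fun x : R[i] * R[i] => l x.1 + l x.2)%R.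
  by apply: measurable_funD; apply: (measurableT_comp measurable_log1n).
have il2 : (nu \x nu).-integrable setT (fun x => (l x.1 + l x.2)%:E).
  apply/integrableP; split; first exact/measurable_EFinP.
  by under eq_integral do rewrite /= ger0_norm ?addr_ge0 ?log1n_ge0//.
have ik : (nu \x nu).-integrable setT kk.
  apply/integrableP; split; first exact: measurable_pair_kernel.
  by under eq_integral do rewrite gee0_abs ?pair_kernel_ge0//.
have iH : nu.-integrable setT H.
  apply/integrableP; split; first exact: measurable_reduced_potential.
  by under eq_integral do rewrite gee0_abs ?reduced_potential_ge0//.
have -> : log_energy nu = \int[nu \x nu]_x kk x - 2%:E * \int[nu]_z (l z)%:E.
  rewrite -integral_log1n2 -integralB//; apply: eq_integral => x _.
  by rewrite /= /kk addeK.
have -> : \int[nu]_z potential v z =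
    \int[nu]_z H z + \int[nu]_z (l z)%:E - (ln B)%:E.
  under eq_integral do rewrite potential_reduced EFinB addeA.
  rewrite integralB//; last 2 first.
  - exact: integrableD.
  - exact: finite_measure_integrable_cst.
  by rewrite integralD// integral_cst//= probability_setT mule1.
rewrite /reduced_energy.
move: (integrable_fin_num measurableT ik) (integrable_fin_num measurableT iH)
  (integrable_fin_num measurableT il) => /=.
case: (\int[nu \x nu]_x kk x) => // k _; case: (\int[nu]_z H z) => // h _.
case: (\int[nu]_z (l z)%:E) => // s _.
rewrite -!EFinM -!EFinB /dual_adde/=; congr EFin; ring.
Qed.

End energy.

(** * The support of the equilibrium measure is bounded *)

Section minimizer.
Context {R : realType} (Sigma : set R[i]) (w : R[i] -> R) (B : R).
Hypotheses (cS : closed Sigma) (adm : admissible Sigma w).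
Local Notation v := (w \_ Sigma).
Hypotheses (B0 : 0 < B) (vB : forall z, v z * (1 + normc z) <= B).
Local Open Scope ereal_scope.
Local Notation l := (@log1n R).
Local Notation kk := (@pair_kernel R).
Local Notation H := (reduced_potential Sigma w B).

Let mS : measurable Sigma. Proof. exact: closed_measurableC. Qed.
Let mH := measurable_reduced_potential Sigma w B cS adm B0.
Let mkk := @measurable_pair_kernel R.
Let H0 := reduced_potential_ge0 Sigma w B B0 vB.
Let l0 (z : R[i]) : 0 <= (l z)%:E. Proof. by rewrite lee_fin log1n_ge0. Qed.

Lemma conditioned_full (P nu : probability R[i] R) (D A : set R[i]) :
  measurable D -> measurable A -> 0 < P D -> conditioned P D nu ->
  P (D `\` A) = 0 -> nu A = 1.
Proof.
move=> mD mA D0 nuP DA0.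
have Doo : P D \is a fin_num by exact: fin_num_measure.
have : P D * nu (~` A) = 0.
  by rewrite nuP; [rewrite setIC -setDE|exact: measurableC].
move=> /eqP; rewrite mule_eq0 gt_eqF//= => /eqP nuA0.
by rewrite -[A]setCK probability_setC ?nuA0 ?sube0//; exact: measurableC.
Qed.

Lemma log_capacity_gt0 (E : set R[i]) : 0 < log_capacity E ->
  exists2 rho : probability R[i] R,
    (exists K : set R[i], [/\ compact K, K `<=` E & rho K = 1]) &
    log_energy rho < +oo.
Proof.
rewrite /log_capacity; set I := ereal_inf _ => cap.
have /ereal_inf_lt[_ [rho h <-] rhof] : I < +oo.
  by move: cap; case: I => [r| |] /=; rewrite ?ltxx ?ltry ?ltNyr.
by exists rho.
Qed.

(** Positive capacity gives a measure rho of finite logarithmic energy on a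
    compact set where w > 0.  The potential need not be rho-integrable, but some
    set w >= 1/(n+1) has positive rho-measure, and the potential is bounded
    there: rho conditioned on this set has finite weighted energy. *)
Lemma exists_finite_energy :
  exists nu : probability R[i] R, nu Sigma = 1 /\ finite_energy Sigma w B nu.
Proof.
have [w0 _ cap _] := adm.
have [rho [K [cK KE rhoK]] kf] := log_capacity_gt0 _ cap.
have [M KM] := compact_normc_bounded K cK.
have mK : measurable K.
  apply: closed_measurableC; apply: compact_closed cK.
  exact: norm_hausdorff.
have rhoKC := probability_eq1_setC _ _ mK rhoK.
have lf : \int[rho]_z (l z)%:E < +oo.
  rewrite -(integral_full_set rho K)//; last exact: measurable_EFin_log1n.
  apply: (@le_lt_trans _ _ (\int[rho]_(z in K) (ln (1 + M))%:E)); last first.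
    by rewrite integral_cst// [X in _ * X]rhoK mule1 ltry.
  apply: ge0_le_integral => //.
    by apply: measurable_funTS; exact: measurable_EFin_log1n.
  move=> z Kz; have zM := KM _ Kz; have zn := normc_ge0 z.
  rewrite lee_fin /log1n ler_ln ?lerD2l ?posrE//; lra.
have kkf := pair_kernel_lty _ lf kf.
pose A n := [set z | (n.+1%:R^-1 <= v z)%R].
have mA n : measurable (A n).
  rewrite -[A n]setCK; apply: measurableC; apply: open_measurableC.
  have -> : ~` A n = [set z | (v z < n.+1%:R^-1)%R].
    by apply/seteqP; split => z /=; rewrite ltNge => /negP.
  exact: patch_weight_usc.
have [n An] : exists n, 0 < rho (A n).
  apply: contrapT => /forallNP h.
  have : rho.-negligible (\bigcup_n A n).
    apply: negligible_bigcup => n; apply/negligibleP => //.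
    by apply/eqP; rewrite -measure_le0 leNgt; apply/negP; exact: h.
  have KA : K `<=` \bigcup_n A n.
    move=> z /KE[zS wz]; exists (Num.truncn (w z)^-1) => //.
    rewrite /A /= patchE mem_set// invf_ple ?posrE//.
    by rewrite ltW// truncnS_gt.
  move=> /(negligibleS KA) /(negligibleP _ mK) rhoK0.
  have : (1 : \bar R) = 0 by rewrite -rhoK.
  by move/eqP; rewrite onee_eq0.
have [nu nuP] := exists_conditioned rho (A n) (mA n) An.
exists nu; split.
  apply: (conditioned_full rho nu (A n)) => //.
  rewrite (_ : _ `\` _ = set0) ?measure0//.
  apply/seteqP; split => z //= [Az zS]; move: Az.
  by rewrite /A/= patchE memNset// leNgt invr_gt0 ltr0n.
have Afin : rho (A n) \is a fin_num by exact: fin_num_measure.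
split.
- apply: (mule_lty_cancel _ _ An); apply: le_lt_trans lf.
  apply: (conditioned_integral_le _ (A n)) => //.
    exact: measurable_EFin_log1n.
- apply: (mule_lty_cancel _ _ An).
  rewrite (conditioned_integral _ (A n))//.
  set c := (- ln (n.+1%:R^-1 / B))%R.
  apply: (@le_lt_trans _ _ (\int[rho]_(z in A n) c%:E)); last first.
    by rewrite integral_cst// -[X in _ * X]fineK// -EFinM ltry.
  apply: ge0_le_integral => //; first exact: measurable_funTS.
  by move=> z Az; apply: reduced_potential_le => //; rewrite invr_gt0.
- apply: (mule_lty_cancel _ _ An); apply: (mule_lty_cancel _ _ An).
  apply: le_lt_trans kkf.
  by apply: (conditioned_integral2_le _ (A n)) => //; exact: pair_kernel_ge0.
Qed.

Lemma finite_energy_lty (nu : probability R[i] R) : nu Sigma = 1 ->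
  finite_energy Sigma w B nu ->
  weighted_energy Sigma w nu < +oo.
Proof.
move=> nuS fin; rewrite (weighted_energyE _ _ B)//.
have [_ Hf kf] := fin; rewrite /reduced_energy.
apply: lte_add_pinfty; last exact: ltry.
by apply: lte_add_pinfty => //; apply: lte_mul_pinfty => //; rewrite lee_fin.
Qed.

(** The arithmetic behind the restriction to a disk D of mass [a].  Here [k] and
    [h] are the integrals of the pair kernel and of the reduced potential for
    the minimizer, [k'] and [h'] those for the conditioned measure, and [hD] is
    the part of [h] that comes from D.  With E = k + 2 h, the hypotheses give
    E >= a^2 E + 2 (E + 1) (1 - a), that is
    0 >= (1 - a) ((1 - a) E + 2). *)
Lemma restriction_energy_gap (k h k' h' hD a : R) :
  (0 <= k)%R -> (0 <= h)%R -> (0 <= k')%R -> (0 <= h')%R ->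
  (0 < a)%R -> (a <= 1)%R ->
  (a * (a * k') <= k)%R -> (a * h' = hD)%R ->
  (hD + (k + 2 * h + 1) * (1 - a) <= h)%R ->
  (k + 2 * h <= k' + 2 * h')%R -> a = 1%R.
Proof.
move=> k0 h0 k0' h0' a0 a1 kk' hh' tail gap.
apply/eqP; rewrite eq_le a1 /= leNgt; apply/negP => {}a1.
have e1 : (0 <= (1 - a) * (a * h'))%R by rewrite !mulr_ge0// ?subr_ge0 ?ltW.
have e2 : (a * (a * (k + 2 * h)) <= a * (a * (k' + 2 * h')))%R.
  by do 2! (apply: ler_wpM2l; first exact: ltW).
have e3 :
    (a * (a * (k + 2 * h)) + 2 * ((k + 2 * h + 1) * (1 - a)) <= k + 2 * h)%R.
  by move: hh' tail e1 e2 kk' => <-; lra.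
have e4 : (0 <= (1 - a) * (1 - a) * (k + 2 * h))%R.
  by rewrite !mulr_ge0// ?subr_ge0 ?(ltW a1)// addr_ge0// mulr_ge0.
lra.
Qed.

(** The disk is chosen so that the reduced potential is at least E + 1 outside,
    where E is the reduced energy of the minimizer; [restriction_energy_gap]
    then compares the minimizer with its conditioning on the disk. *)
Lemma equilibrium_measure_bounded (mu : probability R[i] R) :
  equilibrium_measure Sigma w mu ->
  exists M : R, mu [set z | (normc z <= M)%R] = 1.
Proof.
move=> [muS mumin].
have [nu0 [nu0S nu0f]] := exists_finite_energy.
have fmu : finite_energy Sigma w B mu.
  apply: finite_energyP => //; apply: le_lt_trans (mumin _ nu0S) _.
  exact: finite_energy_lty.
have [lf Hf kf] := fmu.
have k0 (nu : probability R[i] R) : 0 <= \int[nu \x nu]_x kk x.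
  by apply: integral_ge0 => x _; exact: pair_kernel_ge0.
have h0 (nu : probability R[i] R) : 0 <= \int[nu]_z H z by apply: integral_ge0.
pose k := fine (\int[mu \x mu]_x kk x).
pose h := fine (\int[mu]_z H z).
have kE : \int[mu \x mu]_x kk x = k%:E by rewrite fineK// ge0_fin_numE.
have hE : \int[mu]_z H z = h%:E by rewrite fineK// ge0_fin_numE.
pose L := (k + 2 * h + 1)%R.
have [|M hM] := patch_weight_decay Sigma w adm (B * expR (- L))%R.
  by rewrite mulr_gt0// expR_gt0.
exists M; set D := mkset _.
have mD : measurable D by apply: closed_measurableC; exact: closed_normc_le.
have LH z : (~` D) z -> L%:E <= H z.
  move=> /negP; rewrite -ltNge => /hM /ltW.
  exact: reduced_potential_ge.
have mDfin : mu D \is a fin_num by exact: fin_num_measure.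
pose a := fine (mu D).
have aE : mu D = a%:E by rewrite fineK.
have a0 : (0 <= a)%R by rewrite fine_ge0.
have a1 : (a <= 1)%R by rewrite -lee_fin -aE probability_le1.
have k0' : (0 <= k)%R by rewrite -lee_fin -kE.
have h0' : (0 <= h)%R by rewrite -lee_fin -hE.
pose hD := fine (\int[mu]_(z in D) H z).
have hDE : \int[mu]_(z in D) H z = hD%:E.
  rewrite fineK// ge0_fin_numE; last by apply: integral_ge0.
  by apply: le_lt_trans Hf; apply: ge0_subset_integral.
have tail : (hD + L * (1 - a) <= h)%R.
  rewrite -lee_fin -hE EFinD -hDE -(setUv D) ge0_integral_setU//; first last.
  - by rewrite disj_set2E setICr.
  - exact: measurable_funTS.
  - exact: measurableC.
  rewrite leeD2l// EFinM EFinB -aE -probability_setC//.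
  rewrite -integral_cst//; last exact: measurableC.
  apply: ge0_le_integral => //; first exact: measurableC.
  - by move=> z _; rewrite lee_fin /L; lra.
  - exact: measurable_funTS.
have [D0|D0] := leP (mu D) 0.
  (* Without mass on the disk there is nothing to condition on, but then
     E >= 2 (E + 1), since all the mass lies where the reduced potential is at
     least E + 1. *)
  exfalso; have {}a0 : a = 0%R.
    by apply/eqP; rewrite eq_le a0 andbT -lee_fin -aE.
  have : (0 <= hD)%R by rewrite -lee_fin -hDE; apply: integral_ge0.
  by move: tail; rewrite a0 /L; lra.
have [nu nuP] := exists_conditioned mu D mD D0.
have nuS : nu Sigma = 1.
  apply: (conditioned_full mu nu D) => //.
  apply/eqP; rewrite -measure_le0 -(probability_eq1_setC _ _ mS muS).
  apply: le_measure; rewrite ?inE; [exact: measurableD|exact: measurableC|].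
  by move=> z [].
have k2 := conditioned_integral2_le _ D nu _ mD D0 nuP mkk pair_kernel_ge0.
have hD' := conditioned_integral _ D nu _ mD D0 nuP mH H0.
have fnu : finite_energy Sigma w B nu.
  split.
  - apply: (mule_lty_cancel _ _ D0); apply: le_lt_trans lf.
    apply: (conditioned_integral_le _ D) => //.
    exact: measurable_EFin_log1n.
  - by apply: (mule_lty_cancel _ _ D0); rewrite hD' hDE ltry.
  - apply: (mule_lty_cancel _ _ D0); apply: (mule_lty_cancel _ _ D0).
    exact: le_lt_trans kf.
have [_ Hf' kf'] := fnu.
pose k' := fine (\int[nu \x nu]_x kk x).
pose h' := fine (\int[nu]_z H z).
have kE' : \int[nu \x nu]_x kk x = k'%:E by rewrite fineK// ge0_fin_numE.
have hE' : \int[nu]_z H z = h'%:E by rewrite fineK// ge0_fin_numE.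
rewrite aE; congr EFin; apply: (restriction_energy_gap k h k' h' hD) => //.
- by rewrite -lee_fin -kE'.
- by rewrite -lee_fin -hE'.
- by rewrite -lte_fin -aE.
- by move: k2; rewrite aE kE kE' -!EFinM lee_fin.
- by move: hD'; rewrite aE hDE hE' -EFinM => -[].
- have := mumin nu nuS; rewrite !(weighted_energyE _ _ B)// /reduced_energy.
  by rewrite kE hE kE' hE' -!EFinM -!EFinD lee_fin lerD2r.
Qed.

End minimizer.

Lemma equilibrium_support_bounded (R : realType) (Sigma : set R[i])
    (w : R[i] -> R) (mu : probability R[i] R) : closed Sigma ->
  admissible Sigma w -> equilibrium_measure Sigma w mu ->
  exists M : R, forall z, measure_support mu z -> normc z <= M.
Proof.
move=> cS adm eq; have [B B0 vB] := patch_weight_bounded Sigma w cS adm.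
have [M muM] := equilibrium_measure_bounded Sigma w B cS adm B0 vB mu eq.
exists M => z zmu; rewrite leNgt; apply/negP => Mz.
have cD := closed_normc_le M.
have mu0 := probability_eq1_setC mu _ (closed_measurableC _ cD) muM.
have : (0 < mu (~` [set z : R[i] | (normc z <= M)%R]))%E.
  by apply: zmu; [exact: closed_openC|apply/negP; rewrite -ltNge].
by rewrite mu0 ltxx.
Qed.

(** * Roots and the convex hull of the support *)

Theorem proposition2p1 (R : realType) (Sigma : set R[i])
    (sigma : {measure set R[i] -> \bar R}) (w : R[i] -> R) (p : R)
    (mu : probability R[i] R) (P : nat -> {poly R[i]}) :
  closed Sigma ->
  reference_measure Sigma sigma ->
  admissible Sigma w ->
  equilibrium_measure Sigma w mu ->
  1 <= p ->
  well_posed Sigma sigma w p ->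
  localization Sigma sigma w p (measure_support mu) ->
  (forall n : nat, (0 < n)%N -> optimal_poly Sigma sigma w p n (P n)) ->
  (forall K : set R[i], closed K ->
     K `<=` ~` closed_convex_hull (measure_support mu) ->
     exists n1 : nat, forall n : nat, (n1 < n)%N ->
       forall z : R[i], K z -> ~~ root (P n) z) /\
  (forall eps : R, 0 < eps ->
     exists n0 : nat, forall n : nat, (n0 < n)%N ->
       forall z : R[i], root (P n) z ->
         exists2 y : R[i], closed_convex_hull (measure_support mu) y &
           normc (z - y) <= eps).
Proof.
move=> cS _ adm eq p1 wp loc opt.
have p0 : 0 < p by exact: lt_le_trans p1.
have mS := closed_measurableC _ cS.
have mw : measurable_fun Sigma w.
  by apply/(measurable_restrictT w mS); exact: measurable_patch_weight.
have bnd := equilibrium_support_bounded R Sigma w mu cS adm eq.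
have noroot := optimal_poly_no_root Sigma sigma w p cS mw p0 _ P bnd wp loc opt.
split; first exact: noroot.
move=> eps eps0; set Co := closed_convex_hull _.
have [|z zCo|n1 n1P] := noroot (~` neighbourhood Co eps).
- by apply: open_closedC; exact: neighbourhood_open.
- by move=> zCo'; apply: zCo; exact: sub_neighbourhood.
exists n1 => n n1n z rz.
have [[y Coy zy]|nz] := pselect (neighbourhood Co eps z).
  by exists y => //; exact: ltW.
by have := n1P n n1n z nz; rewrite rz.
Qed.
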